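(* Let $(Q,+,\cdot,\le)$ be an ordered field and $n\ge 2$, and assume $n=2$ or that $(Q,+,\cdot,\le)$ is a Euclidean field. Consider the formulas (using 4 variables) $$\Psi_{\sigma\to\tau}(x,y):=x\neq y\wedge\forall z\big(z=x\vee z=y\vee\exists u\,(u\,\sigma\,z\wedge\neg(u\,\sigma\,x)\wedge\neg(u\,\sigma\,y))\big),$$ $$\Psi_{\sigma\to\lambda}(x,y):=\neg\Psi_{\sigma\to\tau}(x,y)\wedge\neg(x\,\sigma\,y)\wedge x\neq y.$$ Then in the structure $(Q^n,\sigma)$, $\Psi_{\sigma\to\tau}$ defines the relation $\tau$ and $\Psi_{\sigma\to\lambda}$ defines the relation $\lambda$.
   Context: For $p=(p_0,\dots,p_{n-1}),\,q=(q_0,\dots,q_{n-1})\in Q^n$: $p\,\tau\,q$ iff $(p_0-q_0)^2>\sum_{i=1}^{n-1}(p_i-q_i)^2$; $p\,\lambda\,q$ iff $(p_0-q_0)^2=\sum_{i=1}^{n-1}(p_i-q_i)^2$ and $p_0\neq q_0$; $p\,\sigma\,q$ iff $(p_0-q_0)^2<\sum_{i=1}^{n-1}(p_i-q_i)^2$. An ordered field is Euclidean if every nonnegative element is a square. A formula $\varphi(x,y)$ defines relation $R$ in $(Q^n,\sigma)$ if for all $a,b\in Q^n$, $\varphi(a,b)$ holds (interpreting the symbol $\sigma$ as the relation $\sigma$, quantifiers ranging over $Q^n$) iff $(a,b)\in R$. *)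

(* Defs.v *)
From mathcomp Require Import all_boot all_order all_algebra.

Set Implicit Arguments.
Unset Strict Implicit.
Unset Printing Implicit Defensive.

Import GRing.Theory Num.Theory.
Local Open Scope ring_scope.

(* Points of Q^d, with d = n.+1 >= 1 so that the coordinate p_0 exists. *)
Notation point Q n := 'rV[Q]_n.+1.

Section Relations.
Variables (Q : realFieldType) (n : nat).
Implicit Types p q : point Q n.

Definition time_dist2 p q : Q := (p ord0 ord0 - q ord0 ord0) ^+ 2.

Definition space_dist2 p q : Q :=
  \sum_(i < n.+1 | i != ord0) (p ord0 i - q ord0 i) ^+ 2.

Definition timelike : rel (point Q n) :=
  fun p q => space_dist2 p q < time_dist2 p q.

Definition lightlike : rel (point Q n) :=
  fun p q => (time_dist2 p q == space_dist2 p q)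
             && (p ord0 ord0 != q ord0 ord0).

Definition spacelike : rel (point Q n) :=
  fun p q => time_dist2 p q < space_dist2 p q.

End Relations.

Definition euclidean_field (Q : realFieldType) : Prop :=
  forall a : Q, 0 <= a -> exists b : Q, a = b ^+ 2.

(* First-order formulas with equality over one binary relation symbol, in which
   at most the k variables indexed by 'I_k occur, free or bound. *)
Inductive formula (k : nat) : Type :=
| FEq of 'I_k & 'I_k
| FRel of 'I_k & 'I_k
| FNot of formula k
| FAnd of formula k & formula k
| FOr of formula k & formula k
| FForall of 'I_k & formula k
| FExists of 'I_k & formula k.

Fixpoint sat (k : nat) (T : Type) (S : rel T) (e : 'I_k -> T)
    (f : formula k) : Prop :=
  match f with
  | FEq i j => e i = e j
  | FRel i j => S (e i) (e j)
  | FNot g => ~ sat S e g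
  | FAnd g h => sat S e g /\ sat S e h
  | FOr g h => sat S e g \/ sat S e h
  | FForall i g => forall a : T, sat S [eta e with i |-> a] g
  | FExists i g => exists a : T, sat S [eta e with i |-> a] g
  end.

(* The formula f(x, y) defines R in the structure (T, S); the values which the
   assignment e gives to the variables other than x and y are arbitrary. *)
Definition defines (k : nat) (T : Type) (S : rel T) (x y : 'I_k)
    (f : formula k) (R : rel T) : Prop :=
  forall (a b : T) (e : 'I_k -> T), e x = a -> e y = b ->
    sat S e f <-> R a b.

Definition vx : 'I_4 := @Ordinal 4 0 isT.
Definition vy : 'I_4 := @Ordinal 4 1 isT.
Definition vz : 'I_4 := @Ordinal 4 2 isT.
Definition vu : 'I_4 := @Ordinal 4 3 isT.

Definition Psi_tau : formula 4 :=
  FAnd (FNot (FEq vx vy))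
       (FForall vz
          (FOr (FEq vz vx)
          (FOr (FEq vz vy)
               (FExists vu
                  (FAnd (FRel vu vz)
                  (FAnd (FNot (FRel vu vx))
                        (FNot (FRel vu vy)))))))).

Definition Psi_lambda : formula 4 :=
  FAnd (FNot Psi_tau) (FAnd (FNot (FRel vx vy)) (FNot (FEq vx vy))).

(* Main.v *)
(** Write [p.q] for the Minkowski form.  The parallelogram law gives, for the
    midpoint [m] of [x] and [y],
    [2 (u-m)^2 = (u-x)^2 + (u-y)^2 - (x-y)^2 / 2],
    so if [x], [y] are not timelike related, [z := m] refutes Psi_tau.
    If they are timelike related and [z] differs from both, then [u := x] or
    [u := y] works unless [p := z - x] and [q := z - y] are both non-spacelike.
    If both are null, then [2 p.q = - (x-y)^2 < 0] and [u := m] works.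
    Otherwise [u := z + eps w] with [w] spacelike, [eps] small, and [w.p > 0]
    (resp. [w.q > 0]) if [p] (resp. [q]) is null. *)
Require Import Defs.
From mathcomp Require Import all_boot all_order all_algebra.
From mathcomp Require Import ring lra.

Set Implicit Arguments.
Unset Strict Implicit.
Unset Printing Implicit Defensive.

Import Order.TTheory GRing.Theory Num.Theory.

Section Minkowski.
Local Open Scope ring_scope.
Variables (Q : realFieldType) (n : nat).
Implicit Types (p q u w x y z : point Q n) (c e : Q).

(** * The Minkowski form, of signature [(+,-,...,-)] *)

Definition mink p q : Q :=
  p ord0 ord0 * q ord0 ord0 -
  \sum_(i < n.+1 | i != ord0) p ord0 i * q ord0 i.

Lemma minkC p q : mink p q = mink q p.
Proof. by rewrite /mink mulrC; under eq_bigr do rewrite mulrC. Qed.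

Lemma minkDl p q w : mink (p + q) w = mink p w + mink q w.
Proof.
rewrite /mink !mxE.
under eq_bigr do rewrite !mxE mulrDl.
by rewrite big_split /=; ring.
Qed.

Lemma minkZl c p w : mink (c *: p) w = c * mink p w.
Proof.
rewrite /mink !mxE.
under eq_bigr do rewrite !mxE -mulrA.
by rewrite -mulr_sumr; ring.
Qed.

Lemma minkNl p w : mink (- p) w = - mink p w.
Proof. by rewrite -scaleN1r minkZl mulN1r. Qed.

Lemma minkDr p q w : mink w (p + q) = mink w p + mink w q.
Proof. by rewrite minkC minkDl !(minkC w). Qed.

Lemma minkZr c p w : mink w (c *: p) = c * mink w p.
Proof. by rewrite minkC minkZl (minkC w). Qed.

Lemma minkNr p w : mink w (- p) = - mink w p.
Proof. by rewrite minkC minkNl (minkC w). Qed.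

Definition minkE := (minkDl, minkDr, minkZl, minkZr, minkNl, minkNr).

Lemma mink_delta p i : i != ord0 ->
  mink p (delta_mx ord0 i) = - p ord0 i.
Proof.
move=> i0; rewrite /mink !mxE eqxx eq_sym (negbTE i0) mulr0 sub0r.
rewrite (bigD1 i) //= big1 => [|j /andP[_ ji]].
  by rewrite addr0 !mxE !eqxx mulr1.
by rewrite !mxE (negbTE ji) andbF mulr0.
Qed.

Lemma mink_delta0 p : mink p (delta_mx ord0 ord0) = p ord0 ord0.
Proof.
rewrite /mink !mxE !eqxx mulr1 big1 ?subr0 // => j j0.
by rewrite !mxE (negbTE j0) andbF mulr0.
Qed.

(** * The three relations as sign conditions on the form *)

Lemma mink_subE p q :
  mink (p - q) (p - q) = time_dist2 p q - space_dist2 p q.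
Proof.
rewrite /mink /time_dist2 /space_dist2 !mxE -expr2; congr (_ - _).
by apply: eq_bigr => i _; rewrite !mxE -expr2.
Qed.

Lemma timelikeE p q : timelike p q = (0 < mink (p - q) (p - q)).
Proof. by rewrite mink_subE subr_gt0. Qed.

Lemma spacelikeE p q : spacelike p q = (mink (p - q) (p - q) < 0).
Proof. by rewrite mink_subE subr_lt0. Qed.

(** With time coordinate zero the form is minus a sum of squares, so nonnegativity forces every
    spatial coordinate to vanish. *)
Lemma mink_ge0_time_neq0 p : 0 <= mink p p -> p != 0 -> p ord0 ord0 != 0.
Proof.
move=> pp; apply: contraNneq => p0; move: pp.
rewrite /mink p0 mulr0 sub0r oppr_ge0 => s_le0.
have sq_ge0 i : i != ord0 -> 0 <= p ord0 i * p ord0 i.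
  by rewrite -expr2 sqr_ge0.
have /eqP : \sum_(i < n.+1 | i != ord0) p ord0 i * p ord0 i = 0.
  by apply/eqP; rewrite eq_le s_le0 sumr_ge0.
rewrite psumr_eq0 // => /allP sq0.
apply/eqP/rowP => i; rewrite mxE.
have [->//|i0] := eqVneq i ord0.
by have := sq0 i (mem_index_enum i); rewrite i0 /= mulf_eq0 orbb => /eqP.
Qed.

Lemma lightlikeE p q :
  lightlike p q = (mink (p - q) (p - q) == 0) && (p != q).
Proof.
rewrite /lightlike mink_subE subr_eq0; case: eqP => //= tsE.
apply/idP/idP; first by apply: contraNneq => ->.
rewrite -subr_eq0 => /mink_ge0_time_neq0.
by rewrite mink_subE tsE subrr lexx !mxE subr_eq0; apply.
Qed.

Lemma midpoint_subl x y z :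
  mink (z - 2^-1 *: (x + y)) (z - 2^-1 *: (x + y)) =
  2^-1 * (mink (z - x) (z - x) + mink (z - y) (z - y))
  - 4^-1 * mink (x - y) (x - y).
Proof.
by rewrite !minkE !(minkC x z) !(minkC y z) !(minkC y x); field.
Qed.

(** * Small perturbations of non-spacelike vectors *)

Lemma quadratic_ge0_near0 (a b c : Q) : 0 < a ->
  exists2 d, 0 < d & forall e, 0 <= e <= d -> 0 <= a + e * b + e ^+ 2 * c.
Proof.
(* The explicit bound [d = a / s] replaces continuity: it is at most 1, so [e ^+ 2 <= e], and
   [e * s <= a] then absorbs both error terms. *)
move=> a0; pose s := a + `|b| + `|c|.
have [b0 c0] : 0 <= `|b| /\ 0 <= `|c| by [].
have s0 : 0 < s by rewrite /s; lra.
exists (a / s); first exact: divr_gt0.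
move=> e /andP[e0]; rewrite ler_pdivlMr // => es.
have e1 : e <= 1.
  by rewrite -(ler_pM2r s0) (le_trans es) // mul1r /s; lra.
have eb : - (e * `|b|) <= e * b.
  by rewrite -mulrN ler_wpM2l // lerNl -normrN ler_norm.
have ec : - (e * `|c|) <= e ^+ 2 * c.
  apply: le_trans (_ : - (e ^+ 2 * `|c|) <= _).
    by rewrite lerN2 ler_wpM2r // expr2 ler_piMr.
  by rewrite -mulrN ler_wpM2l ?sqr_ge0 // lerNl -normrN ler_norm.
have ea : 0 <= e * a by rewrite mulr_ge0 // ltW.
by move: es; rewrite /s !mulrDr; lra.
Qed.

Lemma mink_ge0_shift p w :
    0 < mink p p \/ mink p p = 0 /\ 0 < mink p w ->
  exists2 d, 0 < d &
    forall e, 0 <= e <= d -> 0 <= mink (p + e *: w) (p + e *: w).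
Proof.
case=> [pp|[pp pw]].
  have [d d0 dP] := quadratic_ge0_near0 (2 * mink p w) (mink w w) pp.
  by exists d => // e /dP; rewrite !minkE (minkC w p); lra.
(* For null [p] the square of [p + e *: w] is [e] times [2 p.w + e w.w], whose constant term is
   positive. *)
have [d d0 dP] := quadratic_ge0_near0 (mink w w) 0 (mulr_gt0 (ltr0Sn _ 1) pw).
exists d => // e ed; rewrite !minkE (minkC w p) pp.
have /andP[e0 _] := ed.
by have := mulr_ge0 e0 (dP _ ed); lra.
Qed.

Lemma small_spacelike_shift p q w :
    mink w w < 0 ->
    0 < mink p p \/ mink p p = 0 /\ 0 < mink p w ->
    0 < mink q q \/ mink q q = 0 /\ 0 < mink q w ->
  exists v, [/\ mink v v < 0, 0 <= mink (p + v) (p + v)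
              & 0 <= mink (q + v) (q + v)].
Proof.
move=> ww /mink_ge0_shift[d d0 dP] /mink_ge0_shift[d' d'0 dP'].
pose e := Num.min d d'; have e0 : 0 < e by rewrite lt_min d0.
exists (e *: w); split.
- by rewrite minkZl minkZr pmulr_rlt0 // pmulr_rlt0.
- by apply: dP; rewrite (ltW e0) ge_min lexx.
- by apply: dP'; rewrite (ltW e0) ge_min lexx orbT.
Qed.

Lemma null_spacelike_direction p : p != 0 -> mink p p = 0 ->
  exists2 w, mink w w < 0 & 0 < mink p w.
Proof.
move=> pn0 pp; pose d : point Q n := delta_mx ord0 ord0.
(* Since [p] is null, [p.w] equals this square and [w.w] its negative. *)
have p0 : 0 < p ord0 ord0 ^+ 2.
  by rewrite exprn_even_gt0 //= mink_ge0_time_neq0 ?pp.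
(* The witness is the spatial part of [- p]. *)
exists (p ord0 ord0 *: d - p); rewrite !minkE pp mink_delta0; last first.
  by move: p0; rewrite expr2; lra.
by rewrite (minkC d p) !mink_delta0 mxE !eqxx /=; move: p0; rewrite expr2; lra.
Qed.

Lemma spacelike_shift p q : (0 < n)%N ->
    p != 0 -> q != 0 -> 0 <= mink p p -> 0 <= mink q q ->
    0 < mink (p - q) (p - q) ->
  exists v, [/\ mink v v < 0, 0 <= mink (p + v) (p + v)
              & 0 <= mink (q + v) (q + v)].
Proof.
move=> n0 pn0 qn0; rewrite !le_eqVlt.
move=> /predU1P[/esym pp|pp] /predU1P[/esym qq|qq] pq.
(* The shifted vectors are [(p - q) / 2] and its opposite, and [v.v = p.q / 2 = - (p - q)^2 / 4]. *)
- exists (- (2^-1 *: (p + q))); move: pq.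
  by rewrite !minkE (minkC q p) pp qq => pq; split; lra.
- have [w ww pw] := null_spacelike_direction pn0 pp.
  by apply: small_spacelike_shift ww _ _; [right|left].
- have [w ww qw] := null_spacelike_direction qn0 qq.
  by apply: small_spacelike_shift ww _ _; [left|right].
(* Any spacelike direction will do here; [0 < n] makes the last axis spatial. *)
- have mx0 : (ord_max : 'I_n.+1) != ord0 by rewrite -val_eqE /= -lt0n.
  apply: (@small_spacelike_shift p q (delta_mx ord0 ord_max)); [|by left..].
  by rewrite mink_delta // mxE !eqxx oppr_lt0 ltr01.
Qed.

(** * Witnesses for the quantifiers of [Psi_tau] *)

Lemma timelike_witness x y z : (0 < n)%N -> timelike x y -> z != x -> z != y ->
  exists u, [/\ spacelike u z, ~~ spacelike u x & ~~ spacelike u y].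
Proof.
move=> n0; have opp u v : mink (u - v) (u - v) = mink (v - u) (v - u).
  by rewrite -opprB minkNl minkNr opprK.
have self u : mink (u - u) (u - u) = 0 by rewrite subrr -(scale0r u) minkZl mul0r.
rewrite timelikeE => xy zx zy.
have [zx_lt0|zx_ge0] := ltP (mink (z - x) (z - x)) 0.
  by exists x; rewrite !spacelikeE self ltxx opp zx_lt0 -leNgt ltW.
have [zy_lt0|zy_ge0] := ltP (mink (z - y) (z - y)) 0.
  by exists y; rewrite !spacelikeE self ltxx opp zy_lt0 -leNgt opp ltW.
have xy_diff : 0 < mink (z - x - (z - y)) (z - x - (z - y)).
  by rewrite opprB addrC addrA subrK opp.
have [v [vv vx vy]] : exists v, [/\ mink v v < 0,
    0 <= mink (z - x + v) (z - x + v) & 0 <= mink (z - y + v) (z - y + v)].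
  by apply: spacelike_shift; rewrite ?subr_eq0.
exists (z + v); rewrite !spacelikeE -!leNgt.
by rewrite ![z + v - _]addrAC subrr add0r.
Qed.

Lemma midpoint_not_spacelike x y u : ~~ timelike x y ->
  ~~ spacelike u x -> ~~ spacelike u y -> ~~ spacelike u (2^-1 *: (x + y)).
Proof.
rewrite timelikeE !spacelikeE -!leNgt midpoint_subl; lra.
Qed.

(** Excludes the disjuncts [z = x] and [z = y] when the midpoint is used to refute [Psi_tau]. *)
Lemma midpoint_neq x y : x != y ->
  2^-1 *: (x + y) != x /\ 2^-1 *: (x + y) != y.
Proof.
have two0 : (2 : Q) != 0 by rewrite pnatr_eq0.
have halfE (a b : point Q n) : (2^-1 *: (a + b) == a) = (b == a).
  rewrite -(inj_eq (scalerI two0)) scalerA divff // scale1r scaler_nat mulr2n.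
  exact: can_eq (addKr a) _ _.
by move=> xy; rewrite halfE eq_sym xy addrC halfE xy.
Qed.

Lemma sat_Psi_tau (e : 'I_4 -> point Q n) : (0 < n)%N ->
  sat (@spacelike Q n) e Psi_tau <-> timelike (e vx) (e vy).
Proof.
move=> n0 /=; set x := e vx; set y := e vy; split=> [[/eqP xy all_z]|xy].
  have [//|nt] := boolP (timelike x y).
  have [/eqP zx /eqP zy] := midpoint_neq xy.
  case: (all_z (2^-1 *: (x + y))) => [//|[//|[u [uz [/negP ux /negP uy]]]]].
  by have := midpoint_not_spacelike nt ux uy; rewrite uz.
split=> [xyE|z]; first by
  move: xy; rewrite xyE timelikeE subrr -(scale0r 0) minkZl mul0r ltxx.
have [->|zx] := eqVneq z x; first by left.
have [->|zy] := eqVneq z y; first by right; left.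
have [u [uz ux uy]] := timelike_witness n0 xy zx zy.
by right; right; exists u; split; [|split; apply/negP].
Qed.

End Minkowski.

Theorem theorem3p2 (Q : realFieldType) (n : nat) (hn : (2 <= n.+1)%N)
    (hQ : n.+1 = 2 \/ euclidean_field Q) :
  defines (@spacelike Q n) vx vy Psi_tau (@timelike Q n) /\
  defines (@spacelike Q n) vx vy Psi_lambda (@lightlike Q n).
Proof.
split=> a b e <- <-; first exact: sat_Psi_tau.
(* Only the outer connectives are unfolded, so that [sat_Psi_tau] still applies; trichotomy of the
   sign of the form does the rest. *)
rewrite -[sat _ _ _]/(~ sat _ e Psi_tau /\ ~ spacelike (e vx) (e vy) /\ e vx <> e vy).
rewrite lightlikeE; split=> [[nt [/negP ns /eqP ->]]|/andP[/eqP l /eqP xy]].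
  have /negP : ~ timelike (e vx) (e vy) by move=> /(sat_Psi_tau e hn).
  by move: ns; rewrite timelikeE spacelikeE -!leNgt andbT eq_le => -> ->.
split; first by move=> /(sat_Psi_tau e hn); rewrite timelikeE l ltxx.
by split=> //; rewrite spacelikeE l ltxx.
Qed.
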